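(* There exist a group $H$ with a finite generating set $X$ and elements $g_1,g_2\in H$ of infinite order such that, with respect to the word metric of $X$, $g_1$ and $g_2$ are forward equivalent but not backward equivalent, i.e. $s(g_1^\infty,g_2^\infty)=0$ but $s(g_1^{-\infty},g_2^{-\infty})\neq 0$.
   Context: Let $G$ be a group with finite generating set $X$ and let $d$ be the word metric: $d(g,h)$ is the length of a shortest word over $X\cup X^{-1}$ representing $g^{-1}h$. For $g\in G$ of infinite order put $g^\infty=\{g^n:n\in\mathbb N\}$, $g^{-\infty}=(g^{-1})^\infty=\{g^{-n}:n\in\mathbb N\}$. For $\alpha>0$, $c\in\mathbb N$ the $(\alpha,c)$-cone around $g^\infty$ is $\alpha\cdot g^\infty+c=\{v\in G:\exists n\in\mathbb N,\ d(v,g^n)\le \alpha\, d(1,g^n)+c\}$. For $x=h^\infty$ write $x\subseteq \alpha\cdot g^\infty+c$ if every element of $x$ lies in this cone. For two such forward orbits $x,y$ define $s(x,y)=\inf\{\alpha>0:\exists c\in\mathbb N \text{ with } x\subseteq\alpha\cdot y+c \text{ and } y\subseteq \alpha\cdot x+c\}$. Elements $g,h$ are forward equivalent if $s(g^\infty,h^\infty)=0$ and backward equivalent if $s(g^{-\infty},h^{-\infty})=0$. *)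

(* Defs.v *)
From Stdlib Require Import Reals List.
Import ListNotations.
Open Scope R_scope.

Record Group := {
  carrier :> Type;
  gmul : carrier -> carrier -> carrier;
  gone : carrier;
  ginv : carrier -> carrier;
  gmul_assoc : forall a b c, gmul a (gmul b c) = gmul (gmul a b) c;
  gmul_1l : forall a, gmul gone a = a;
  gmul_1r : forall a, gmul a gone = a;
  gmul_Vl : forall a, gmul (ginv a) a = gone;
  gmul_Vr : forall a, gmul a (ginv a) = gone
}.

Section G.
Variable G : Group.

Fixpoint gpow (g : G) (n : nat) : G :=
  match n with O => gone G | S k => gmul G g (gpow g k) end.

Definition infinite_order (g : G) : Prop :=
  forall n : nat, (0 < n)%nat -> gpow g n <> gone G.

Definition is_word (X : list G) (w : list G) : Prop :=
  Forall (fun a => In a X \/ In (ginv G a) X) w.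

Definition eval_word (w : list G) : G := fold_right (gmul G) (gone G) w.

Definition generates (X : list G) : Prop :=
  forall g : G, exists w, is_word X w /\ eval_word w = g.

Definition word_dist (X : list G) (g h : G) (k : nat) : Prop :=
  (exists w, is_word X w /\ eval_word w = gmul G (ginv G g) h /\ length w = k)
  /\ (forall w, is_word X w -> eval_word w = gmul G (ginv G g) h -> (k <= length w)%nat).

Definition in_cone (X : list G) (alpha : R) (c : nat) (g v : G) : Prop :=
  exists n : nat, exists k1 k2 : nat,
    word_dist X v (gpow g n) k1 /\ word_dist X (gone G) (gpow g n) k2 /\
    INR k1 <= alpha * INR k2 + INR c.

Definition orbit_in_cone (X : list G) (h : G) (alpha : R) (c : nat) (g : G) : Prop :=
  forall m : nat, in_cone X alpha c g (gpow h m).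

Definition s_admissible (X : list G) (g h : G) (alpha : R) : Prop :=
  0 < alpha /\ exists c : nat, orbit_in_cone X g alpha c h /\ orbit_in_cone X h alpha c g.

(* s(g^inf, h^inf) = 0 : the infimum of the admissible set (a subset of
   (0,inf)) is 0, i.e. admissible alphas exist arbitrarily close to 0 *)
Definition s_zero (X : list G) (g h : G) : Prop :=
  forall eps : R, 0 < eps -> exists alpha, s_admissible X g h alpha /\ alpha < eps.

Definition forward_equivalent (X : list G) (g h : G) : Prop := s_zero X g h.
Definition backward_equivalent (X : list G) (g h : G) : Prop :=
  s_zero X (ginv G g) (ginv G h).

End G.

(* Main.v *)
Require Import Defs.
From Stdlib Require Import Reals List.
From Stdlib Require Import ZArith Lia Lra Wf_nat Classical.
From Stdlib Require Import FunctionalExtensionality ProofIrrelevance.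
Import ListNotations.

(** Let [Rev] be the permutation of the integers that fixes the negative ones
    and reverses each block [k^2, (k+1)^2) of the others.  In the graph on Z
    with edges [s -- s+1] and [s -- Rev s], a point [n >= 0] is within
    [4 sqrt n] of [0], whereas [-n] is at distance [n].  Put a lamp at every
    integer, let [Down] be the shift [s |-> s-1], and let [Flip] switch the lamp
    at [0].  In the group generated by [Down], [Rev] and [Flip], switching the
    lamp at [s] costs about twice the distance from [0] to [s].  For
    [g1 = Down] and [g2 = Flip Down Flip], the element [g1^-n g2^n] switches the
    lamps at [0] and [n], so it has length O(sqrt n), while [g1^n g2^-n] switches
    those at [0] and [-n], so it has length at least [n]. *)

(** * Permutation groups generated by a set of letters closed under inversion *)

Section GeneratedGroup.

Variables (S L : Type) (act : L -> S -> S) (linv : L -> L).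
Hypothesis linvK : forall l, linv (linv l) = l.
Hypothesis actK : forall l x, act (linv l) (act l x) = x.

Definition run (w : list L) (x : S) : S := fold_right act x w.
Definition winv (w : list L) : list L := rev (map linv w).

Lemma run_app v w x : run (v ++ w) x = run v (run w x).
Proof. apply fold_right_app. Qed.

Lemma winvK w : winv (winv w) = w.
Proof.
  unfold winv. rewrite map_rev, rev_involutive, map_map.
  rewrite (map_ext _ (fun l => l)) by exact linvK. apply map_id.
Qed.

Lemma winv_app v w : winv (v ++ w) = winv w ++ winv v.
Proof. unfold winv. now rewrite map_app, rev_app_distr. Qed.

Lemma run_winv w x : run (winv w) (run w x) = x.
Proof.
  induction w as [|l w IH]; [reflexivity|].
  change (l :: w) with ([l] ++ w).
  rewrite winv_app, !run_app. simpl. now rewrite actK.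
Qed.

(* A permutation is stored together with its inverse, so that inversion needs
   no choice of a word. *)
Definition elt : Type :=
  { p : (S -> S) * (S -> S) | exists w, p = (run w, run (winv w)) }.

Definition val (g : elt) : S -> S := fst (proj1_sig g).

Definition of_word (w : list L) : elt :=
  exist _ (run w, run (winv w)) (ex_intro _ w eq_refl).

Lemma elt_word (g : elt) : exists w, g = of_word w.
Proof.
  destruct g as [p Hp]. destruct Hp as [w Hw]. exists w.
  now subst p.
Qed.

(** The stored inverse is determined by the permutation, since it is the run of an inverse word; the
    existence proof is irrelevant. *)
Lemma elt_ext (g h : elt) : (forall x, val g x = val h x) -> g = h.
Proof.
  intros E.
  destruct (elt_word g) as [v ->], (elt_word h) as [w ->].
  unfold val in E; simpl in E.
  assert (E1 : run v = run w) by (now apply functional_extensionality).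
  assert (E2 : run (winv v) = run (winv w)).
  { apply functional_extensionality; intros x.
    rewrite <- (run_winv (winv w) x) at 1.
    now rewrite winvK, <- E, run_winv. }
  apply eq_sig_hprop; [intros; apply proof_irrelevance|].
  simpl. now rewrite E1, E2.
Qed.

Definition elt_mul (g h : elt) : elt.
Proof.
  exists (fun x => fst (proj1_sig g) (fst (proj1_sig h) x),
          fun x => snd (proj1_sig h) (snd (proj1_sig g) x)).
  destruct g as [p [v Hv]], h as [q [w Hw]]; simpl; subst p q; simpl.
  exists (v ++ w).
  f_equal; apply functional_extensionality; intros x;
    now rewrite ?winv_app, run_app.
Defined.

Definition elt_inv (g : elt) : elt.
Proof.
  exists (snd (proj1_sig g), fst (proj1_sig g)).
  destruct g as [p [w Hw]]; simpl; subst p; simpl.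
  exists (winv w). now rewrite winvK.
Defined.

Lemma val_mul g h x : val (elt_mul g h) x = val g (val h x).
Proof. reflexivity. Qed.

Lemma val_inv_l g x : val (elt_inv g) (val g x) = x.
Proof. destruct (elt_word g) as [w ->]. apply run_winv. Qed.

Lemma val_inv_r g x : val g (val (elt_inv g) x) = x.
Proof.
  destruct (elt_word g) as [w ->]. unfold val; simpl.
  rewrite <- (winvK w) at 1. apply run_winv.
Qed.

Definition generated_group : Group.
Proof.
  refine {| carrier := elt; gmul := elt_mul; gone := of_word nil;
            ginv := elt_inv |};
    intros; apply elt_ext; intros x; rewrite ?val_mul; try reflexivity.
  - apply val_inv_l.
  - apply val_inv_r.
Defined.

Definition gen (l : L) : generated_group := of_word [l].

Lemma val_gpow (g : generated_group) n x :
  val (gpow generated_group g n) x = Nat.iter n (val g) x.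
Proof.
  induction n as [|n IH]; [reflexivity|].
  simpl. now rewrite <- IH.
Qed.

Lemma eval_map_gen v :
  eval_word generated_group (map gen v) = of_word v.
Proof.
  induction v as [|l v IH]; [reflexivity|].
  change (eval_word generated_group (map gen (l :: v))) with
    (elt_mul (gen l) (eval_word generated_group (map gen v))).
  rewrite IH. now apply elt_ext.
Qed.

(** * The word metric in terms of lists of letters *)

Section Metric.

Variable ls : list L.
Hypothesis ls_all : forall l, In l ls.

Let X : list generated_group := map gen ls.

Lemma is_word_map_gen v : is_word generated_group X (map gen v).
Proof.
  apply Forall_forall; intros a Ha.
  apply in_map_iff in Ha. destruct Ha as [l [<- _]].
  left. now apply in_map.
Qed.

(** If the inverse of [a] is [gen l], then [a] is [gen (linv l)], so formal inverses of generators
    add no new letters. *)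
Lemma is_word_gen w : is_word generated_group X w -> exists v, w = map gen v.
Proof.
  induction 1 as [|a w Ha Hw [v ->]]; [now exists nil|].
  assert (exists l, a = gen l) as [l ->].
  { destruct Ha as [Ha|Ha]; apply in_map_iff in Ha; destruct Ha as [l [E _]].
    - now exists l.
    - exists (linv l). apply elt_ext; intros x.
      change (ginv generated_group a) with (elt_inv a) in E.
      rewrite <- (val_inv_l a x) at 2. rewrite <- E.
      symmetry. apply actK. }
  now exists (l :: v).
Qed.

Lemma generated_group_generates : generates generated_group X.
Proof.
  intros g. destruct (elt_word g) as [v ->].
  exists (map gen v). split; [apply is_word_map_gen | apply eval_map_gen].
Qed.

(** The form [g v = h] of [v = g^-1 h], which can be checked pointwise without computing an
    inverse. *)
Definition connects (g h : generated_group) (v : list L) : Prop :=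
  forall x, val g (run v x) = val h x.

Lemma connects_eval g h v :
  connects g h v <->
  eval_word generated_group (map gen v)
  = gmul generated_group (ginv generated_group g) h.
Proof.
  rewrite eval_map_gen. split.
  - intros C. apply elt_ext; intros x. simpl. rewrite val_mul, <- C.
    now rewrite val_inv_l.
  - intros E x. change (run v x) with (val (of_word v) x). rewrite E.
    apply val_inv_r.
Qed.

Lemma word_dist_connects g h k :
  word_dist generated_group X g h k ->
  exists v, length v = k /\ connects g h v.
Proof.
  intros [[w [Hw [E <-]]] _].
  destruct (is_word_gen w Hw) as [v ->].
  exists v. split; [now rewrite length_map | now apply connects_eval].
Qed.

Lemma connects_word_dist g h v :
  connects g h v ->
  exists k, word_dist generated_group X g h k /\ (k <= length v)%nat.
Proof.
  intros C.
  (* A shortest connecting list exists by well-ordering; excluded middle supplies the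
     decidability. *)
  destruct (dec_inh_nat_subset_has_unique_least_element
              (fun k => exists u, length u = k /\ connects g h u))
    as [k [[[u [Hu Cu]] Hmin] _]].
  - intros n. apply classic.
  - now exists (length v), v.
  - exists k. split; [split|].
    + exists (map gen u). rewrite length_map.
      split; [apply is_word_map_gen | split; [now apply connects_eval | easy]].
    + intros w Hw E. destruct (is_word_gen w Hw) as [v' ->].
      rewrite length_map. apply Hmin. exists v'.
      split; [easy | now apply connects_eval].
    + apply Hmin. now exists v.
Qed.

Lemma connects_exists g h : exists v, connects g h v.
Proof.
  destruct (elt_word (gmul generated_group (ginv generated_group g) h))
    as [v E].
  exists v. apply connects_eval. now rewrite eval_map_gen.
Qed.

Lemma word_dist_exists g h : exists k, word_dist generated_group X g h k.
Proof.
  destruct (connects_exists g h) as [v C].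
  destruct (connects_word_dist g h v C) as [k [Hk _]]. now exists k.
Qed.

End Metric.
End GeneratedGroup.

(** * The block reversal and the action of the four letters *)

Open Scope Z_scope.

Inductive letter := Down | Up | Rev | Flip.

Definition letters : list letter := [Down; Up; Rev; Flip].

Definition letter_inv (l : letter) : letter :=
  match l with Down => Up | Up => Down | Rev => Rev | Flip => Flip end.

(** With [k = Z.sqrt s], the endpoints [k^2] and [k^2 + 2k] of the block of [s] add up to
    [2k(k+1)]. *)
Definition reverse_block (s : Z) : Z :=
  if s <? 0 then s else 2 * Z.sqrt s * (Z.sqrt s + 1) - s.

(* Multiplication by the switch of the lamp at [n], as a permutation of the
   set of (lamp, state) pairs. *)
Definition flip_at (n : Z) (x : Z * bool) : Z * bool :=
  (fst x, if fst x =? n then negb (snd x) else snd x).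

Definition shift (k : Z) (x : Z * bool) : Z * bool := (fst x + k, snd x).

Definition letter_act (l : letter) (x : Z * bool) : Z * bool :=
  match l with
  | Down => shift (-1) x
  | Up => shift 1 x
  | Rev => (reverse_block (fst x), snd x)
  | Flip => flip_at 0 x
  end.

Lemma reverse_block_spec k i :
  0 <= k -> 0 <= i <= 2 * k ->
  reverse_block (k * k + i) = k * k + (2 * k - i).
Proof.
  intros Hk Hi. unfold reverse_block.
  rewrite (Z.sqrt_unique (k * k + i) k) by nia.
  destruct (Z.ltb_spec (k * k + i) 0); nia.
Qed.

Lemma reverse_block_neg s : s < 0 -> reverse_block s = s.
Proof. intros Hs. unfold reverse_block. now rewrite (proj2 (Z.ltb_lt _ _) Hs). Qed.

Lemma block_decomp s :
  0 <= s -> exists k i, 0 <= k /\ 0 <= i <= 2 * k /\ s = k * k + i.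
Proof.
  intros Hs. pose proof (Z.sqrt_spec s Hs) as Hk. pose proof (Z.sqrt_nonneg s).
  cbv zeta in Hk. rewrite <- Z.add_1_r in Hk.
  exists (Z.sqrt s), (s - Z.sqrt s * Z.sqrt s). lia.
Qed.

Lemma reverse_block_nonneg s : 0 <= s -> 0 <= reverse_block s.
Proof.
  intros Hs. destruct (block_decomp s Hs) as (k & i & Hk & Hi & ->).
  rewrite reverse_block_spec by lia. nia.
Qed.

Lemma reverse_blockK s : reverse_block (reverse_block s) = s.
Proof.
  destruct (Z.lt_ge_cases s 0) as [Hs|Hs].
  - now rewrite !reverse_block_neg by (rewrite ?reverse_block_neg; easy).
  - destruct (block_decomp s Hs) as (k & i & Hk & Hi & ->).
    rewrite !reverse_block_spec by (try rewrite reverse_block_spec; lia). lia.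
Qed.

Lemma flip_atK n x : flip_at n (flip_at n x) = x.
Proof.
  destruct x as [s b]. unfold flip_at; simpl.
  destruct (s =? n); now rewrite ?Bool.negb_involutive.
Qed.

Lemma shift_shift j k x : shift j (shift k x) = shift (k + j) x.
Proof. unfold shift; simpl. f_equal. lia. Qed.

Lemma shift0 x : shift 0 x = x.
Proof. destruct x as [s b]. unfold shift; simpl. f_equal. lia. Qed.

Lemma shift_flip_at k n x : shift k (flip_at n x) = flip_at (n + k) (shift k x).
Proof.
  unfold shift, flip_at; simpl. f_equal.
  destruct (Z.eqb_spec (fst x) n), (Z.eqb_spec (fst x + k) (n + k)); lia || easy.
Qed.

Lemma letter_invK l : letter_inv (letter_inv l) = l.
Proof. now destruct l. Qed.

Lemma letter_actK l x : letter_act (letter_inv l) (letter_act l x) = x.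
Proof.
  destruct l; simpl.
  - rewrite shift_shift. apply shift0.
  - rewrite shift_shift. apply shift0.
  - destruct x; simpl. now rewrite reverse_blockK.
  - apply flip_atK.
Qed.

Lemma letters_all l : In l letters.
Proof. destruct l; simpl; tauto. Qed.

(** * Short words switching the lamp at a nonnegative integer *)

Notation lrun := (run (Z * bool) letter letter_act).

(** The length [k] need not be minimal: only upper bounds are drawn from it. *)
Definition flip_word (n : Z) (k : nat) : Prop :=
  exists w, length w = k /\ forall x, lrun w x = flip_at n x.

Lemma flip_word_0 : flip_word 0 1.
Proof. now exists [Flip]. Qed.

Lemma flip_word_succ n k : flip_word n k -> flip_word (n + 1) (2 + k).
Proof.
  intros [w [<- Hw]]. exists (Up :: w ++ [Down]). split.
  - simpl. rewrite length_app. simpl. lia.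
  - intros x. change (Up :: w ++ [Down]) with ([Up] ++ w ++ [Down]).
    rewrite !run_app. rewrite Hw. simpl.
    rewrite shift_flip_at, shift_shift. f_equal. apply shift0.
Qed.

(** Conjugating a switch by a permutation of the positions moves its lamp along; [Rev] is its own
    inverse. *)
Lemma flip_word_reverse n k : flip_word n k -> flip_word (reverse_block n) (2 + k).
Proof.
  intros [w [<- Hw]]. exists (Rev :: w ++ [Rev]). split.
  - simpl. rewrite length_app. simpl. lia.
  - intros [s b]. change (Rev :: w ++ [Rev]) with ([Rev] ++ w ++ [Rev]).
    rewrite !run_app. rewrite Hw. unfold flip_at; simpl.
    rewrite reverse_blockK. f_equal.
    destruct (Z.eqb_spec (reverse_block s) n) as [E|E],
      (Z.eqb_spec s (reverse_block n)) as [F|F]; try easy.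
    + destruct F. now rewrite <- E, reverse_blockK.
    + destruct E. now rewrite F, reverse_blockK.
Qed.

(** Reversal takes [q^2] to the end [q^2 + 2q] of its block, and one step up reaches [(q+1)^2]. Each
    of the two conjugations adds two letters, hence four per block. *)
Lemma flip_word_square (q : nat) :
  flip_word (Z.of_nat q * Z.of_nat q) (1 + 4 * q).
Proof.
  induction q as [|q IH]; [exact flip_word_0|].
  apply flip_word_reverse, flip_word_succ in IH.
  rewrite <- (Z.add_0_r (Z.of_nat q * Z.of_nat q)) in IH.
  rewrite reverse_block_spec in IH by lia.
  replace (Z.of_nat (S q) * Z.of_nat (S q))
    with (Z.of_nat q * Z.of_nat q + (2 * Z.of_nat q - 0) + 1) by nia.
  now replace (1 + 4 * S q)%nat with (2 + (2 + (1 + 4 * q)))%nat by lia.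
Qed.

Lemma flip_word_add n k (i : nat) :
  flip_word n k -> flip_word (n + Z.of_nat i) (2 * i + k).
Proof.
  intros H. induction i as [|i IH].
  - now rewrite Z.add_0_r.
  - apply flip_word_succ in IH.
    replace (n + Z.of_nat (S i)) with (n + Z.of_nat i + 1) by lia.
    now replace (2 * S i + k)%nat with (2 + (2 * i + k))%nat by lia.
Qed.

(** Go to the largest square [q^2 <= n], then up by at most [2q] single steps: [1 + 4q + 2 * 2q]
    letters suffice. *)
Lemma flip_word_short (n : nat) :
  exists q k : nat,
    (q * q <= n)%nat /\ (k <= 1 + 8 * q)%nat /\ flip_word (Z.of_nat n) k.
Proof.
  pose proof (Nat.sqrt_spec n (Nat.le_0_l n)) as Hq.
  set (q := Nat.sqrt n) in *. simpl in Hq.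
  pose proof (flip_word_add _ _ (n - q * q) (flip_word_square q)) as H.
  exists q, (2 * (n - q * q) + (1 + 4 * q))%nat.
  split; [nia | split; [nia|]].
  now replace (Z.of_nat n)
    with (Z.of_nat q * Z.of_nat q + Z.of_nat (n - q * q)) by nia.
Qed.

(** * Lower bounds from the depth below zero *)

Definition depth (x : Z * bool) : Z := Z.max 0 (- fst x).

(** [Rev] fixes negative positions and keeps the others nonnegative, so only [Down] and [Up] can
    change the depth. *)
Lemma letter_act_depth l x : depth (letter_act l x) <= depth x + 1.
Proof.
  unfold depth. destruct l; simpl; try lia.
  destruct (Z.lt_ge_cases (fst x) 0) as [Hx|Hx].
  - rewrite reverse_block_neg; lia.
  - pose proof (reverse_block_nonneg _ Hx). lia.
Qed.

Lemma run_depth w x : depth (lrun w x) <= depth x + Z.of_nat (length w).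
Proof.
  induction w as [|l w IH]; [simpl; lia|].
  pose proof (letter_act_depth l (lrun w x)). simpl in *. lia.
Qed.

Lemma letter_act_depth_ge l x : depth x - 1 <= depth (letter_act l x).
Proof.
  pose proof (letter_act_depth (letter_inv l) (letter_act l x)) as H.
  rewrite letter_actK in H. lia.
Qed.

Lemma run_depth_ge w x : depth x - Z.of_nat (length w) <= depth (lrun w x).
Proof.
  induction w as [|l w IH]; [simpl; lia|].
  pose proof (letter_act_depth_ge l (lrun w x)). simpl in *. lia.
Qed.

(** Whenever a letter acts, fewer letters than the initial depth have acted before it, so the
    position is still negative and [Flip] has no effect. *)
Lemma run_deep_snd w x :
  Z.of_nat (length w) <= depth x -> snd (lrun w x) = snd x.
Proof.
  induction w as [|l w IH]; [reflexivity|].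
  intros H. simpl length in H.
  rewrite <- IH by lia.
  pose proof (run_depth_ge w x) as D. simpl.
  destruct l; try reflexivity. simpl.
  destruct (Z.eqb_spec (fst (lrun w x)) 0) as [E|E]; [|reflexivity].
  unfold depth in D at 2. lia.
Qed.

(** * The group, the powers of the two elements, and their distances *)

Definition lamp_group : Group :=
  generated_group (Z * bool) letter letter_act letter_inv letter_invK letter_actK.

Definition lamp_gen : letter -> lamp_group :=
  gen (Z * bool) letter letter_act letter_inv letter_invK letter_actK.

Definition lamp_gens : list lamp_group := map lamp_gen letters.

Definition g1 : lamp_group := lamp_gen Down.
Definition g2 : lamp_group :=
  gmul lamp_group (lamp_gen Flip) (gmul lamp_group (lamp_gen Down) (lamp_gen Flip)).

Notation lval := (val (Z * bool) letter letter_act letter_inv).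
Notation lconnects :=
  (connects (Z * bool) letter letter_act letter_inv letter_invK letter_actK).

Lemma iter_shift k n x : Nat.iter n (shift k) x = shift (Z.of_nat n * k) x.
Proof.
  induction n as [|n IH]; [symmetry; apply shift0|].
  rewrite Nat.iter_succ, IH, shift_shift. f_equal. lia.
Qed.

Lemma iter_conj_shift k n x :
  Nat.iter n (fun y => flip_at 0 (shift k (flip_at 0 y))) x
  = flip_at 0 (shift (Z.of_nat n * k) (flip_at 0 x)).
Proof.
  induction n as [|n IH]; [simpl; now rewrite shift0, flip_atK|].
  rewrite Nat.iter_succ, IH, flip_atK, shift_shift. f_equal. f_equal. lia.
Qed.

Lemma val_g1_pow n x : lval (gpow lamp_group g1 n) x = shift (- Z.of_nat n) x.
Proof.
  etransitivity; [apply val_gpow|].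
  change (lval g1) with (shift (-1)). rewrite iter_shift. f_equal. lia.
Qed.

Lemma val_g2_pow n x :
  lval (gpow lamp_group g2 n) x
  = flip_at 0 (shift (- Z.of_nat n) (flip_at 0 x)).
Proof.
  etransitivity; [apply val_gpow|].
  change (lval g2) with (fun y => flip_at 0 (shift (-1) (flip_at 0 y))).
  rewrite iter_conj_shift. f_equal. f_equal. lia.
Qed.

Lemma val_g1_inv_pow n x :
  lval (gpow lamp_group (ginv lamp_group g1) n) x = shift (Z.of_nat n) x.
Proof.
  etransitivity; [apply val_gpow|].
  change (lval (ginv lamp_group g1)) with (shift 1). rewrite iter_shift. f_equal. lia.
Qed.

Lemma val_g2_inv_pow n x :
  lval (gpow lamp_group (ginv lamp_group g2) n) x
  = flip_at 0 (shift (Z.of_nat n) (flip_at 0 x)).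
Proof.
  etransitivity; [apply val_gpow|].
  change (lval (ginv lamp_group g2)) with (fun y => flip_at 0 (shift 1 (flip_at 0 y))).
  rewrite iter_conj_shift. f_equal. f_equal. lia.
Qed.

(** The power takes [(0, false)] from depth 0 to depth [n], and each letter adds at most 1. *)
Lemma g1_pow_length n k :
  word_dist lamp_group lamp_gens (gone lamp_group) (gpow lamp_group g1 n) k ->
  (n <= k)%nat.
Proof.
  intros H. apply word_dist_connects in H. destruct H as [v [<- C]].
  specialize (C (0, false)).
  change (lval (gone lamp_group) (lrun v (0, false))) with (lrun v (0, false)) in C.
  rewrite (val_g1_pow n) in C.
  pose proof (run_depth v (0, false)) as D. rewrite C in D.
  unfold depth in D; simpl in D. lia.
Qed.

Lemma g2_pow_length n k :
  word_dist lamp_group lamp_gens (gone lamp_group) (gpow lamp_group g2 n) k ->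
  (n <= k)%nat.
Proof.
  intros H. apply word_dist_connects in H. destruct H as [v [<- C]].
  specialize (C (0, false)).
  change (lval (gone lamp_group) (lrun v (0, false))) with (lrun v (0, false)) in C.
  rewrite (val_g2_pow n) in C.
  pose proof (run_depth v (0, false)) as D. rewrite C in D.
  unfold depth in D; simpl in D. lia.
Qed.

Lemma g1_infinite_order : infinite_order lamp_group g1.
Proof.
  intros n Hn E. pose proof (val_g1_pow n (0, false)) as V.
  rewrite E in V. apply (f_equal fst) in V. simpl in V. lia.
Qed.

Lemma g2_infinite_order : infinite_order lamp_group g2.
Proof.
  intros n Hn E. pose proof (val_g2_pow n (0, false)) as V.
  rewrite E in V. apply (f_equal fst) in V. simpl in V. lia.
Qed.

(** Moving the outer flip of [g2^n] past the shift by [-n] turns it into the switch at [n], so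
    [g1^-n g2^n] is the product of the switches at [n] and 0. *)
Lemma forward_connects_12 n k :
  flip_word (Z.of_nat n) k ->
  exists v, length v = S k /\
    lconnects (gpow lamp_group g1 n) (gpow lamp_group g2 n) v.
Proof.
  intros [w [<- Hw]]. exists (w ++ [Flip]). split.
  - rewrite length_app. simpl. lia.
  - intros x. rewrite run_app, Hw. rewrite val_g1_pow, val_g2_pow.
    rewrite shift_flip_at. now rewrite Z.add_opp_diag_r.
Qed.

Lemma forward_connects_21 n k :
  flip_word (Z.of_nat n) k ->
  exists v, length v = S k /\
    lconnects (gpow lamp_group g2 n) (gpow lamp_group g1 n) v.
Proof.
  intros [w [<- Hw]]. exists (Flip :: w). split; [reflexivity|].
  intros x. change (lrun (Flip :: w) x) with (flip_at 0 (lrun w x)).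
  rewrite Hw, val_g1_pow, val_g2_pow, flip_atK, shift_flip_at.
  now rewrite Z.add_opp_diag_r, flip_atK.
Qed.

(** Follow the point [(-n, false)]. For [n > 0] its second component must change, so the word has to
    bring it up to 0, which takes at least [n] letters. The word leaves it at position [-m], whence
    [m <= n + k]. *)
Lemma backward_lower_bound m n k :
  word_dist lamp_group lamp_gens
    (gpow lamp_group (ginv lamp_group g1) m)
    (gpow lamp_group (ginv lamp_group g2) n) k ->
  (n <= k)%nat /\ (m <= n + k)%nat.
Proof.
  intros H. apply word_dist_connects in H. destruct H as [v [<- C]].
  specialize (C (- Z.of_nat n, false)).
  rewrite (val_g1_inv_pow m), (val_g2_inv_pow n) in C.
  pose proof (f_equal fst C) as C1. simpl in C1.
  apply (f_equal snd) in C. simpl in C.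
  split.
  - destruct (Nat.le_gt_cases n (length v)) as [Hn|Hn]; [easy|exfalso].
    rewrite run_deep_snd in C by (unfold depth; simpl; lia).
    rewrite Z.add_opp_diag_l in C. simpl in C.
    destruct (Z.eqb_spec (- Z.of_nat n) 0); [lia|easy].
  - pose proof (run_depth v (- Z.of_nat n, false)) as D.
    unfold depth in D. simpl in D. lia.
Qed.

(** The inner flips of the power cancel, leaving [Flip Up^n Flip]. This bounds the radius of the
    cone in the backward case. *)
Lemma g2_inv_pow_length n k :
  word_dist lamp_group lamp_gens (gone lamp_group)
    (gpow lamp_group (ginv lamp_group g2) n) k ->
  (k <= n + 2)%nat.
Proof.
  intros Hk.
  destruct (connects_word_dist _ _ _ _ letter_invK letter_actK letters letters_all
    (gone lamp_group) (gpow lamp_group (ginv lamp_group g2) n)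
    (Flip :: repeat Up n ++ [Flip])) as [k' [Hk' Hle]].
  - intros x. rewrite val_g2_inv_pow.
    change (flip_at 0 (lrun (repeat Up n ++ [Flip]) x)
      = flip_at 0 (shift (Z.of_nat n) (flip_at 0 x))).
    rewrite run_app. f_equal.
    change (lrun [Flip] x) with (flip_at 0 x). generalize (flip_at 0 x).
    clear. intros x. replace (Z.of_nat n) with (Z.of_nat n * 1) by lia.
    rewrite <- iter_shift.
    induction n as [|n IH]; [reflexivity|].
    simpl. now rewrite <- IH.
  - simpl in Hle. rewrite length_app, repeat_length in Hle. simpl in Hle.
    destruct Hk as [_ Hk], Hk' as [[w (Hw & E & L)] _].
    assert (k <= k')%nat by (rewrite <- L; exact (Hk w Hw E)). lia.
Qed.

(** * Cone estimates and conclusion *)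

Open Scope R_scope.

Lemma sqrt_sublinear alpha c n q k1 k2 :
  0 < alpha -> 16 / alpha + 2 <= INR c ->
  (q * q <= n)%nat -> (n <= k2)%nat -> (k1 <= 2 + 8 * q)%nat ->
  INR k1 <= alpha * INR k2 + INR c.
Proof.
  intros Ha Hc Hq Hn Hk.
  apply le_INR in Hq, Hn, Hk.
  rewrite mult_INR in Hq. rewrite plus_INR, mult_INR in Hk.
  simpl (INR 2) in Hk. simpl (INR 8) in Hk.
  (* Complete the square: the difference of the two sides is [(alpha q - 4)^2 / alpha]. *)
  assert (8 * INR q <= alpha * (INR q * INR q) + 16 / alpha).
  { assert (E : alpha * (INR q * INR q) + 16 / alpha - 8 * INR q
              = (alpha * INR q - 4) * (alpha * INR q - 4) / alpha)
      by (field; lra).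
    assert (0 <= (alpha * INR q - 4) * (alpha * INR q - 4) / alpha).
    { apply Rmult_le_pos; [apply Rle_0_sqr|].
      left. now apply Rinv_0_lt_compat. }
    lra. }
  assert (alpha * (INR q * INR q) <= alpha * INR k2)
    by (apply Rmult_le_compat_l; lra).
  lra.
Qed.

Lemma g1_g2_forward_equivalent : forward_equivalent lamp_group lamp_gens g1 g2.
Proof.
  intros eps Heps. exists (eps / 2). split; [|lra].
  split; [lra|].
  destruct (INR_unbounded (16 / (eps / 2) + 2)) as [c Hc].
  exists c.
  (* Each power is compared with the power of the same exponent. *)
  split; intros m; exists m;
    destruct (flip_word_short m) as (q & k & Hq & Hk & Hf).
  - destruct (forward_connects_12 m k Hf) as [v [Hv C]].
    destruct (connects_word_dist _ _ _ _ _ _ letters letters_all _ _ _ C)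
      as [k1 [Hk1 Hle]].
    destruct (word_dist_exists _ _ _ _ letter_invK letter_actK letters letters_all
      (gone lamp_group) (gpow lamp_group g2 m)) as [k2 Hk2].
    exists k1, k2. split; [easy | split; [easy|]].
    apply (sqrt_sublinear _ _ m q); try lra; try lia.
    now apply g2_pow_length.
  - destruct (forward_connects_21 m k Hf) as [v [Hv C]].
    destruct (connects_word_dist _ _ _ _ _ _ letters letters_all _ _ _ C)
      as [k1 [Hk1 Hle]].
    destruct (word_dist_exists _ _ _ _ letter_invK letter_actK letters letters_all
      (gone lamp_group) (gpow lamp_group g1 m)) as [k2 Hk2].
    exists k1, k2. split; [easy | split; [easy|]].
    apply (sqrt_sublinear _ _ m q); try lra; try lia.
    now apply g1_pow_length.
Qed.

Lemma g1_g2_not_backward_equivalent :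
  ~ backward_equivalent lamp_group lamp_gens g1 g2.
Proof.
  intros H. destruct (H (1 / 2)) as [alpha [[Ha [c [Hc _]]] Ha2]]; [lra|].
  (* Since [alpha < 1/2], one gets [2 k1 <= k2 + 2c <= n + 2 + 2c <= k1 + 2 + 2c]. Thus
     [n <= k1 <= 2c + 2], and the exponent is at most [n + k1 <= 4c + 4]; any larger one gives a
     contradiction. *)
  destruct (Hc (4 * c + 8)%nat) as (n & k1 & k2 & H1 & H2 & Hle).
  apply backward_lower_bound in H1. apply g2_inv_pow_length in H2.
  assert (2 * k1 <= k2 + 2 * c)%nat; [|lia].
  apply INR_le. rewrite plus_INR, !mult_INR. simpl (INR 2).
  pose proof (pos_INR k2). nra.
Qed.

Theorem theorem1p1 :
  exists (H : Group) (X : list H) (g1 g2 : H),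
    generates H X /\
    infinite_order H g1 /\ infinite_order H g2 /\
    forward_equivalent H X g1 g2 /\ ~ backward_equivalent H X g1 g2.
Proof.
  exists lamp_group, lamp_gens, g1, g2.
  split; [exact (generated_group_generates _ _ _ _ _ _ _ letters_all)|].
  split; [exact g1_infinite_order|].
  split; [exact g2_infinite_order|].
  split; [exact g1_g2_forward_equivalent | exact g1_g2_not_backward_equivalent].
Qed.
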